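(* The following two statements are equivalent: (1) for every stream $s$, if $\neg\,\nu\mathcal{U}\,s$, then the set $\mathcal{R}_s$ of red positions of $s$ is streamless; (2) for every stream $s$, if $\neg\,\mathit{div}_{\succ_s}\,0$, then every chain $\ell:\mathit{chain}_{\succ_s}\,0$ is finite, i.e. $\ell\downarrow$.
   Context: The equivalence is to be proved constructively (intuitionistic type theory with inductive and coinductive definitions; no excluded middle, no Markov's principle). A color is one of $R$ (red), $B$ (blue). A stream is an element of the coinductive type whose only constructor forms $c\,s$ from a color $c$ and a stream $s$; streams are considered up to bisimilarity (equivalently, functions $\mathbb{N}\to\{R,B\}$ up to pointwise equality). $s@n$ denotes the color of $s$ at position $n$ (positions start at $0$). For a stream predicate $X$, the strong until predicate $\mathcal{U}_X$ is defined inductively by the rules: $\mathcal{U}_X\,s$ implies $\mathcal{U}_X\,(B\,s)$; $X\,s$ implies $\mathcal{U}_X\,(R\,s)$. $\nu\mathcal{U}$ (''infinitely often red'') is the greatest fixed point of the monotone operator $X\mapsto\mathcal{U}_X$, i.e. the predicate defined coinductively by the rule: $\mathcal{U}_{\nu\mathcal{U}}\,s$ implies $\nu\mathcal{U}\,s$. $\mathcal{R}_s=\{n\in\mathbb{N}\mid s@n=R\}$. For a set $A$, the duplicate-free colists $\mathit{colist}\,A$ over $A$ are defined coinductively: $\langle\rangle:\mathit{colist}\,A$; and if $x\in A$ and $\ell:\mathit{colist}\,(A\setminus\{x\})$ then $x\,\ell:\mathit{colist}\,A$. Finiteness $\ell\downarrow$ is defined inductively: $\langle\rangle\downarrow$;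 and $\ell\downarrow$ implies $(x\,\ell)\downarrow$. $A$ is streamless if $\ell\downarrow$ for every $\ell:\mathit{colist}\,A$. For a stream $s$, the relation $\succ_s$ on $\mathbb{N}$ is: $n\succ_s m$ iff there is $\ell$ with $n\le\ell$, $s@k=B$ for all $k$ with $n\le k<\ell$, $s@\ell=R$, and $m=\ell+1$. For a binary relation $\succ$ on a set $U$: antifoundedness is defined coinductively by the rule: if $n\succ m$ and $\mathit{div}_\succ\,m$, then $\mathit{div}_\succ\,n$. Descending chains are defined coinductively: $\langle\rangle:\mathit{chain}_\succ\,x_0$ for $x_0\in U$; and if $x_0\succ x_1$ and $\ell:\mathit{chain}_\succ\,x_1$ then $x_1\,\ell:\mathit{chain}_\succ\,x_0$. Finiteness $\ell\downarrow$ of chains is defined by the same inductive rules as for colists. *)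

(* Defs.v *)
From Stdlib Require Export Streams Relation_Definitions.

(* Everything below lives in axiom-free CIC: no classical library is loaded,
   connectives in [Prop] are read intuitionistically, and data (streams,
   colists, chains) live in [Type]. *)

Inductive color : Set := R | B.

Notation stream := (Stream color).

Inductive U (X : stream -> Prop) : stream -> Prop :=
| U_blue (s : stream) : U X s -> U X (Cons B s)
| U_red (s : stream) : X s -> U X (Cons R s).

(* Infinitely often red.  A direct [CoInductive] with constructor
   [U nuU s -> nuU s] would be accepted, but the guard checker rejects its
   coinduction principle (it needs a [fix] under a [cofix]), so the greatest
   fixed point of [U] is taken as the union of all its post-fixed points.
   [nuU_fold], [nuU_unfold] and [nuU_coind] are the coinductive rule, its
   inversion and coinduction. *)
Definition nuU (s : stream) : Prop :=
  exists X : stream -> Prop, (forall t : stream, X t -> U X t) /\ X s.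

Lemma U_mono (X Y : stream -> Prop) :
  (forall s, X s -> Y s) -> forall s, U X s -> U Y s.
Proof.
  intros XY s u; induction u; [apply U_blue | apply U_red]; auto.
Qed.

Lemma nuU_coind (X : stream -> Prop) :
  (forall s, X s -> U X s) -> forall s, X s -> nuU s.
Proof. intros H s Xs; exists X; split; assumption. Qed.

Lemma nuU_unfold (s : stream) : nuU s -> U nuU s.
Proof.
  intros (X & H & Xs).
  apply U_mono with X; [exact (nuU_coind X H) | exact (H s Xs)].
Qed.

Lemma nuU_fold (s : stream) : U nuU s -> nuU s.
Proof.
  apply (nuU_coind (U nuU)); intros t u.
  apply U_mono with nuU; [exact nuU_unfold | exact u].
Qed.

(* A subset of a type [T] is a predicate on [T]. *)
Definition remove {T : Type} (A : T -> Prop) (x : T) : T -> Prop :=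
  fun y => A y /\ y <> x.

Definition reds (s : stream) : nat -> Prop := fun n => Str_nth n s = R.

(* [A] is a non-uniform parameter: the tail is a colist over [A] minus the
   head, which is what makes the colist duplicate-free. *)
CoInductive colist {T : Type} (A : T -> Prop) : Type :=
| conil : colist A
| cocons (x : T) : A x -> colist (remove A x) -> colist A.

Arguments conil {T A}.
Arguments cocons {T A} x _ _.

Inductive colist_finite {T : Type} (A : T -> Prop) : colist A -> Prop :=
| colist_finite_nil : colist_finite A conil
| colist_finite_cons (x : T) (Ax : A x) (l : colist (remove A x)) :
    colist_finite (remove A x) l -> colist_finite A (cocons x Ax l).

Definition streamless {T : Type} (A : T -> Prop) : Prop :=
  forall l : colist A, colist_finite A l.

(* [next_red s n m]: m is one past the first red position at or after n. *)
Definition next_red (s : stream) : relation nat :=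
  fun n m => exists l : nat,
    n <= l /\ (forall k : nat, n <= k < l -> Str_nth k s = B) /\
    Str_nth l s = R /\ m = l + 1.

(* Antifoundedness. *)
CoInductive div {T : Type} (rel : relation T) (n : T) : Prop :=
| div_step (m : T) : rel n m -> div rel m -> div rel n.

(* The starting point [x0] is not itself an entry of the chain. *)
CoInductive chain {T : Type} (rel : relation T) (x0 : T) : Type :=
| chain_nil : chain rel x0
| chain_cons (x1 : T) : rel x0 x1 -> chain rel x1 -> chain rel x0.

Arguments chain_nil {T rel x0}.
Arguments chain_cons {T rel x0} x1 _ _.

Inductive chain_finite {T : Type} (rel : relation T) (x0 : T) :
    chain rel x0 -> Prop :=
| chain_finite_nil : chain_finite rel x0 chain_nil
| chain_finite_cons (x1 : T) (H : rel x0 x1) (l : chain rel x1) :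
    chain_finite rel x1 l -> chain_finite rel x0 (chain_cons x1 H l).

(* Main.v *)
(** [nuU s] and [div (next_red s) 0] are equivalent, so the two statements have
    the same hypothesis on [s].  A chain for [next_red s] is a strictly
    increasing enumeration of red positions, hence gives a duplicate-free colist
    over [reds s] that terminates only if the chain does.  Conversely, let a
    colist over [reds s] be given.  Among its first [p + 1] entries, which are
    distinct, one is at least [p], unless the colist ends before.  In the former
    case a bounded search finds the first red position from [p] on, which
    extends the chain; in the latter case the chain is stopped.  So the chain
    terminates only if the colist does. *)

From Stdlib Require Import List Arith Lia.
Require Import Defs.

Lemma U_iff_first_red (X : stream -> Prop) (s : stream) :
  U X s <->
  exists l, (forall k, k < l -> Str_nth k s = B) /\ Str_nth l s = R /\
    X (Str_nth_tl (S l) s).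
Proof.
  split.
  - induction 1 as [s _ (l & Hblue & Hred & HX) | s HX].
    + exists (S l); repeat split; try assumption.
      intros [|k] Hk; [reflexivity | apply Hblue; lia].
    + exists 0; repeat split; [lia | exact HX].
  - intros (l & Hblue & Hred & HX); revert s Hblue Hred HX.
    induction l as [|l IH]; intros [c s] Hblue Hred HX.
    + unfold Str_nth in Hred; simpl in Hred; subst c.
      apply U_red; exact HX.
    + assert (c = B) as -> by exact (Hblue 0 (Nat.lt_0_succ l)).
      apply U_blue, IH; try assumption.
      intros k Hk; apply (Hblue (S k)); lia.
Qed.

(** Read on tails of [s], [U] becomes the one-step operator underlying [div (next_red s)]; the two
    greatest fixed points are then compared by coinduction. *)
Lemma U_tl_iff_next_red (X : stream -> Prop) (s : stream) (n : nat) :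
  U X (Str_nth_tl n s) <->
  exists m, next_red s n m /\ X (Str_nth_tl m s).
Proof.
  rewrite U_iff_first_red; split.
  - intros (l & Hblue & Hred & HX).
    rewrite Str_nth_plus in Hred; rewrite Str_nth_tl_plus in HX.
    exists (S l + n); split; [exists (l + n) | exact HX].
    split; [lia | split; [| split; [exact Hred | lia]]].
    intros k Hk; replace k with (k - n + n) by lia.
    rewrite <- Str_nth_plus; apply Hblue; lia.
  - intros (m & (l & Hnl & Hblue & Hred & ->) & HX).
    exists (l - n); rewrite Str_nth_plus, Str_nth_tl_plus.
    replace (l - n + n) with l by lia.
    replace (S (l - n) + n) with (l + 1) by lia.
    repeat split; try assumption.
    intros k Hk; rewrite Str_nth_plus; apply Hblue; lia.
Qed.

Lemma nuU_tl_div (s : stream) :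
  forall n, nuU (Str_nth_tl n s) -> div (next_red s) n.
Proof.
  cofix IH; intros n H.
  apply nuU_unfold, U_tl_iff_next_red in H; destruct H as (m & Hnm & Hm).
  exact (div_step _ n m Hnm (IH m Hm)).
Qed.

Lemma div_nuU_tl (s : stream) (n : nat) :
  div (next_red s) n -> nuU (Str_nth_tl n s).
Proof.
  intros Hn.
  apply nuU_coind
    with (fun t => exists m, t = Str_nth_tl m s /\ div (next_red s) m).
  - intros t (m & -> & Hm); destruct Hm as [p Hmp Hp].
    apply U_tl_iff_next_red; exists p; split; [exact Hmp |].
    exists p; split; [reflexivity | exact Hp].
  - exists n; split; [reflexivity | exact Hn].
Qed.

Lemma nuU_iff_div (s : stream) : nuU s <-> div (next_red s) 0.
Proof. split; [apply (nuU_tl_div s 0) | apply (div_nuU_tl s 0)]. Qed.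

(* Bounding the length by a number turns every finiteness argument below into
   an induction on that number, so no dependent inversion of the finiteness
   predicates is needed. *)
Fixpoint colist_within {T : Type} (k : nat) {A : T -> Prop} (l : colist A)
    : Prop :=
  match l with
  | conil => True
  | cocons _ _ l' =>
      match k with 0 => False | S k' => colist_within k' l' end
  end.

Fixpoint chain_within {T : Type} {rel : relation T} (k : nat) {x : T}
    (c : chain rel x) : Prop :=
  match c with
  | chain_nil => True
  | chain_cons _ _ c' =>
      match k with 0 => False | S k' => chain_within k' c' end
  end.

Lemma colist_finite_iff_within {T : Type} (A : T -> Prop) (l : colist A) :
  colist_finite A l <-> exists k, colist_within k l.
Proof.
  split.
  - induction 1 as [A | A x Ax l _ [k Hk]]; [exists 0 | exists (S k)];
      [exact I | exact Hk].
  - intros [k Hk]; revert A l Hk.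
    induction k as [|k IH]; intros A [|x Ax l] Hk;
      try (apply colist_finite_nil); simpl in Hk; [contradiction |].
    apply colist_finite_cons, IH, Hk.
Qed.

Lemma chain_finite_iff_within {T : Type} (rel : relation T) (x : T)
    (c : chain rel x) :
  chain_finite rel x c <-> exists k, chain_within k c.
Proof.
  split.
  - induction 1 as [x | x y Hxy c _ [k Hk]]; [exists 0 | exists (S k)];
      [exact I | exact Hk].
  - intros [k Hk]; revert x c Hk.
    induction k as [|k IH]; intros x [|y Hxy c] Hk;
      try (apply chain_finite_nil); simpl in Hk; [contradiction |].
    apply chain_finite_cons, IH, Hk.
Qed.

Lemma next_red_pred (s : stream) (n m : nat) :
  next_red s n m -> n <= pred m < m /\ reds s (pred m).
Proof.
  intros (l & Hnl & _ & Hred & ->).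
  replace (pred (l + 1)) with l by lia; split; [lia | exact Hred].
Qed.

(** Invariant of the corecursion from chains to colists, where [A] shrinks with each entry: removing
    [pred m] is harmless since only positions from [m] on are used later. *)
Definition reds_from_in (s : stream) (n : nat) (A : nat -> Prop) : Prop :=
  forall k, n <= k -> reds s k -> A k.

Lemma reds_from_in_head (s : stream) (n m : nat) (A : nat -> Prop) :
  reds_from_in s n A -> next_red s n m -> A (pred m).
Proof.
  intros HA H; apply next_red_pred in H; apply HA; tauto.
Qed.

Lemma reds_from_in_remove (s : stream) (n m : nat) (A : nat -> Prop) :
  reds_from_in s n A -> next_red s n m ->
  reds_from_in s m (remove A (pred m)).
Proof.
  intros HA H k Hk Hred; apply next_red_pred in H.
  split; [apply HA; [lia | exact Hred] | lia].
Qed.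

CoFixpoint colist_of_chain (s : stream) (n : nat) (c : chain (next_red s) n)
    (A : nat -> Prop) (HA : reds_from_in s n A) : colist A :=
  match c with
  | chain_nil => conil
  | chain_cons m H c' =>
      cocons (pred m) (reds_from_in_head s n m A HA H)
        (colist_of_chain s m c' _ (reds_from_in_remove s n m A HA H))
  end.

Lemma colist_of_chain_within (s : stream) (k n : nat)
    (c : chain (next_red s) n) (A : nat -> Prop) (HA : reds_from_in s n A) :
  colist_within k (colist_of_chain s n c A HA) -> chain_within k c.
Proof.
  revert n c A HA; induction k as [|k IH]; intros n [|m H c] A HA Hk;
    simpl in *; trivial.
  exact (IH _ _ _ _ Hk).
Qed.

(** Colors are decidable and [m] bounds the search, so no Markov principle is needed. The result is
    in [Type] because it feeds the corecursive construction of a chain. *)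
Lemma first_red (s : stream) (n m : nat) :
  n <= m -> reds s m -> {q | next_red s n q}.
Proof.
  intros Hnm; replace m with (m - n + n) by lia.
  generalize (m - n) as d; clear m Hnm; intros d; revert n.
  induction d as [|d IH]; intros n Hred.
  - exists (n + 1), n; repeat split; [lia | lia | exact Hred].
  - destruct (Str_nth n s) eqn:E.
    + exists (n + 1), n; repeat split; [lia | lia | exact E].
    + destruct (IH (S n)) as [q Hq].
      * replace (d + S n) with (S d + n) by lia; exact Hred.
      * exists q; destruct Hq as (l & Hnl & Hblue & Hl & ->).
        exists l; repeat split; [lia | | exact Hl].
        intros k Hk; destruct (Nat.eq_dec k n) as [-> | Hkn];
          [exact E | apply Hblue; lia].
Qed.

(* Pigeonhole: [L] lists the elements of [A] below [p]. *)
Lemma colist_large_entry (p k : nat) (A : nat -> Prop) (l : colist A)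
    (L : list nat) :
  length L <= k -> (forall x, A x -> x < p -> In x L) ->
  {m | p <= m /\ A m} + {colist_within k l}.
Proof.
  revert A l L; induction k as [|k IH]; intros A [|x Ax l] L Hlen HL;
    try (right; exact I); destruct (le_lt_dec p x) as [Hpx | Hxp];
    try (left; exists x; split; assumption).
  - exfalso; destruct L; [exact (HL x Ax Hxp) | simpl in Hlen; lia].
  (* As [x < p], the entry [x] is in [L]; deleting it shortens [L] just as the tail's base set loses
     [x]. *)
  - destruct (IH _ l (List.remove Nat.eq_dec x L)) as [(m & Hpm & Am & _) | Hk].
    + pose proof (remove_length_lt Nat.eq_dec L x (HL x Ax Hxp)); lia.
    + intros y [Ay Hyx] Hyp; apply in_in_remove; auto.
    + left; exists m; split; assumption.
    + right; exact Hk.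
Qed.

Lemma next_red_or_within (s : stream) (l : colist (reds s)) (p : nat) :
  {q | next_red s p q} + {colist_within p l}.
Proof.
  destruct (colist_large_entry p p (reds s) l (seq 0 p)) as [(m & Hpm & Hm) | H].
  - rewrite length_seq; lia.
  - intros x _ Hx; apply in_seq; lia.
  - left; exact (first_red s p m Hpm Hm).
  - right; exact H.
Qed.

(** The colist is not consumed: every step consults all of [l] again, with a larger threshold. *)
CoFixpoint chain_of_colist (s : stream) (l : colist (reds s)) (p : nat)
    : chain (next_red s) p :=
  match next_red_or_within s l p with
  | inleft (exist _ q H) => chain_cons q H (chain_of_colist s l q)
  | inright _ => chain_nil
  end.

(** The chain stops only at a position [p] where [l] was found to have at most [p] entries, so [j]
    is that position and is unrelated to [k]. *)
Lemma chain_of_colist_within (s : stream) (l : colist (reds s)) (k p : nat) :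
  chain_within k (chain_of_colist s l p) -> exists j, colist_within j l.
Proof.
  revert p; induction k as [|k IH]; intros p Hk; simpl in Hk;
    destruct (next_red_or_within s l p) as [[q Hq] | Hp];
    try (exists p; exact Hp).
  - contradiction.
  - exact (IH q Hk).
Qed.

Theorem corollary4p3 :
  (forall s : stream, ~ nuU s -> streamless (reds s)) <->
  (forall s : stream, ~ div (next_red s) 0 ->
     forall l : chain (next_red s) 0, chain_finite (next_red s) 0 l).
Proof.
  split; intros H s Hs l.
  - assert (HA : reds_from_in s 0 (reds s)) by (intros k _ Hk; exact Hk).
    rewrite <- nuU_iff_div in Hs.
    specialize (H s Hs (colist_of_chain s 0 l (reds s) HA)).
    apply colist_finite_iff_within in H; destruct H as [k Hk].
    apply chain_finite_iff_within; exists k.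
    exact (colist_of_chain_within s k 0 l (reds s) HA Hk).
  - rewrite nuU_iff_div in Hs.
    specialize (H s Hs (chain_of_colist s l 0)).
    apply chain_finite_iff_within in H; destruct H as [k Hk].
    apply colist_finite_iff_within.
    exact (chain_of_colist_within s l k 0 Hk).
Qed.
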